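(* Let $\mathcal{Q}=(Q_n)_{n\ge 1}$ be a defective adapted cocycle. Assume that $\mathcal{Q}$ has a finite second moment and satisfies the second-moment deviation inequality with respect to the probability measure $\mu$. Assume that $\mathcal{Q}$ is $A$-consistent for a measurable set $A\subseteq G$ with $\mu(A)>0$. Assume that $\ell(\mu;\mathcal{Q})>0$. Then $\sigma^2(\mu;\mathcal{Q})>0$.
   Context: Let $(G,\mathcal{G})$ be a measurable space, $\mu$ a probability measure on $G$, $\Omega=G^{\mathbb{N}^*}$ with $\mathbb{N}^*=\{1,2,\dots\}$, equipped with the product $\sigma$-field and the product measure $\mathbb{P}^\mu=\mu^{\otimes\mathbb{N}^*}$. $\mathbb{E}^\mu$ and $\mathbb{V}^\mu$ denote expectation and variance under $\mathbb{P}^\mu$. $X_n:\Omega\to G$ are the coordinate maps, $\mathcal{F}_n=\sigma(X_1,\dots,X_n)$, and $\theta_n(\omega_1,\omega_2,\dots)=(\omega_{n+1},\omega_{n+2},\dots)$. A defective adapted cocycle is a sequence $\mathcal{Q}=(Q_n)_{n\in\mathbb{N}^*}$ of real-valued maps on $\Omega$ with $Q_n$ measurable with respect to $\mathcal{F}_n$; by convention $Q_0=0$. Its defect is $\Psi_{n,m}(\omega)=Q_{n+m}(\omega)-Q_n(\omega)-Q_m(\theta_n\omega)$, $n,m\in\mathbb{N}$. Finite second moment: $\mathbb{E}^\mu[|Q_1|^2]<\infty$. Second-moment deviation inequality: there is a constant $\tau_2(\mu;\mathcal{Q})<\infty$ with $\mathbb{E}^\mu[|\Psi_{n,m}|^2]\le\tau_2(\mu;\mathcal{Q})$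 for all $n,m\in\mathbb{N}$. Under these assumptions the limits $\ell(\mu;\mathcal{Q}):=\lim_n\frac1n\mathbb{E}^\mu[Q_n]$ and $\sigma^2(\mu;\mathcal{Q}):=\lim_n\frac1n\mathbb{V}^\mu[Q_n]$ exist and are finite. $A$-consistency: for $1\le k\le n$ and a sequence $(X_j)_{j\ge1}$, let $X^{((k))}_j=X_j$ for $j<k$ and $X^{((k))}_j=X_{j+1}$ for $j\ge k$ (the sequence with $X_k$ removed). Write $Q_{n-1}=g_{n-1}(X_1,\dots,X_{n-1})$ with $g_{n-1}$ measurable (and $g_0=0$). $\mathcal{Q}$ is $A$-consistent if for all $1\le k\le n$ and all sequences $(X_j)_{j\ge1}$ in $\Omega$ with $X_k\in A$ one has $Q_n(X_1,\dots,X_n)=g_{n-1}(X^{((k))}_1,\dots,X^{((k))}_{n-1})$. *)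

(* Defs.v *)
From HB Require Import structures.
From mathcomp Require Import all_boot all_order all_algebra.
From mathcomp Require Import all_classical all_reals all_analysis.

Set Implicit Arguments.
Unset Strict Implicit.
Unset Printing Implicit Defensive.

Import Order.TTheory GRing.Theory Num.Theory.
Import numFieldNormedType.Exports.

Local Open Scope classical_set_scope.
Local Open Scope ring_scope.

(* Sequences (X_1, X_2, ...) are indexed from 0: the value of w : nat -> G at
   i is X_{i+1}. *)
Definition coord_sets (d : measure_display) (G : measurableType d) :
    set (set (nat -> G)) :=
  \bigcup_(i in [set: nat])
    preimage_set_system setT (fun w : nat -> G => w i) measurable.

(* The product sigma-field, as the one generated by the coordinate maps. *)
Definition Omega (d : measure_display) (G : measurableType d) :=
  g_sigma_algebraType (@coord_sets d G).

Section cocycles.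
Context (d : measure_display) (G : measurableType d) (R : realType).
Implicit Types (P : probability (Omega G) R) (Q : nat -> Omega G -> R).

(* Since measurable boxes depending on finitely many coordinates form a
   pi-system generating the sigma-field of Omega G, at most one probability P
   satisfies this; the existence of one is classical, for any (G, mu). *)
Definition is_product_measure (mu : probability G R) P : Prop :=
  forall (n : nat) (B : nat -> set G), (forall i, measurable (B i)) ->
    P [set w | forall i, (i < n)%N -> B i (w i)] =
    (\prod_(i < n) mu (B i))%E.

(* F_n = sigma(X_1, ..., X_n) *)
Definition past (n : nat) : set (set (Omega G)) :=
  g_sigma_preimage (fun (i : 'I_n) (w : Omega G) => w i).

Definition shift (n : nat) (w : Omega G) : Omega G := fun i => w (n + i)%N.

Definition defective_adapted_cocycle Q : Prop :=
  (forall w, Q 0%N w = 0) /\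
  (forall n, preimage_set_system setT (Q n) measurable `<=` past n).

Definition defect Q (n m : nat) (w : Omega G) : R :=
  Q (n + m)%N w - Q n w - Q m (shift n w).

Definition finite_second_moment P Q : Prop :=
  ('E_P[fun w => (`|Q 1%N w| ^+ 2)%R] < +oo)%E.

Definition second_moment_deviation P Q : Prop :=
  exists tau : R, forall n m : nat,
    ('E_P[fun w => (`|defect Q n m w| ^+ 2)%R] <= tau%:E)%E.

Definition drift P Q : \bar R :=
  limn (fun n : nat => (n%:R^-1)%:E * 'E_P[Q n])%E.

Definition asymptotic_variance P Q : \bar R :=
  limn (fun n : nat => (n%:R^-1)%:E * 'V_P[Q n])%E.

Definition prefix (n : nat) (w : Omega G) : n.-tuple G :=
  [tuple w i | i < n].

(* remove k w drops the entry w k, that is X_{k+1}: bump k i is i for i < k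
   and i + 1 for k <= i. *)
Definition remove (k : nat) (w : Omega G) : Omega G := fun i => w (bump k i).

(* As prefix n is onto, the g n are determined by Q; they exist whenever Q is
   adapted. *)
Definition consistent (A : set G) Q : Prop :=
  exists g : forall n : nat, n.-tuple G -> R,
    [/\ forall n, measurable_fun [set: n.-tuple G] (g n),
        forall n w, Q n w = g n (prefix n w) &
        forall (n k : nat) (w : Omega G), (k < n)%N -> A (w k) ->
          Q n w = g n.-1 (prefix n.-1 (remove k w))].

End cocycles.

(* Main.v *)
Require Import Defs.
From HB Require Import structures.
From mathcomp Require Import all_boot all_order all_algebra.
From mathcomp Require Import all_classical all_reals all_analysis.
From mathcomp Require Import measurable_realfun.
From mathcomp Require Import zify ring lra.
(* [shift], [prefix] and [remove] must not be shadowed by MathComp's. *)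
Import Defs.

(* Let p = mu(A), let N_n be the number of k <= n with X_k in A, and write
   a_n = E[Q_n]. Removing X_k when X_k is in A turns Q_n into Q_{n-1} evaluated
   at an independent i.i.d. sequence, so E[1_{X_k in A} Q_n] = p a_{n-1} and
   Cov(N_n, Q_n) = - n p (a_n - a_{n-1}). Since V[N_n] = n p (1 - p), the
   Cauchy-Schwarz inequality gives V[Q_n] >= n p (a_n - a_{n-1})^2. As a_n / n
   tends to a positive limit l, the increments a_n - a_{n-1} exceed l / 4
   infinitely often, hence V[Q_n] / n >= p l^2 / 16 infinitely often.

   It remains that V[Q_n] / n converges. By independence of Q_n and of
   Q_m o theta_n, v_n = V[Q_n] satisfies
   |v_{n+m} - v_n - v_m| <= tau + 2 sqrt(tau (v_n + v_m)). Halving indices gives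
   first v_n = O(n), then |v_{km} - k v_m| = O(k sqrt m), so that v_n / n is a
   Cauchy sequence. *)

Set Implicit Arguments.
Unset Strict Implicit.
Unset Printing Implicit Defensive.

Import Order.TTheory GRing.Theory Num.Theory.
Import numFieldNormedType.Exports.

Local Open Scope classical_set_scope.
Local Open Scope ring_scope.

(** * Real sequences that are additive up to a sublinear error *)

Section nearly_additive.
Context {R : realType}.
Implicit Types (v : nat -> R) (c : R).

(* The gain of the factor 5/4 > 1 absorbs error terms of order sqrt n in
   inductions that halve n. *)
Lemma sqrt_half_split (n : nat) : (1 < n)%N ->
  5 / 4 * Num.sqrt n%:R <=
    Num.sqrt (n./2)%:R + Num.sqrt (n - n./2)%:R :> R.
Proof.
move=> n1; set i := n./2; set j := (n - i)%N.
have ij : (i <= j)%N by rewrite /i /j; lia.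
have i1 : (1 <= i)%N by rewrite /i; lia.
have ji : (j <= i.+1)%N by rewrite /i /j; lia.
have nij : n%:R = i%:R + j%:R :> R by rewrite -natrD; congr (_%:R); rewrite /i /j; lia.
have ijR : (i%:R <= j%:R :> R) by rewrite ler_nat.
have i1R : (1 <= i%:R :> R) by rewrite ler1n.
have jiR : (j%:R <= i%:R + 1 :> R) by rewrite natr1 ler_nat.
have si : Num.sqrt i%:R <= Num.sqrt j%:R :> R by rewrite ler_sqrt// ler0n.
have ei : Num.sqrt i%:R ^+ 2 = i%:R :> R by rewrite sqr_sqrtr// ler0n.
have ej : Num.sqrt j%:R ^+ 2 = j%:R :> R by rewrite sqr_sqrtr// ler0n.
have en : Num.sqrt n%:R ^+ 2 = n%:R :> R by rewrite sqr_sqrtr// ler0n.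
have := sqrtr_ge0 (i%:R : R); have := sqrtr_ge0 (j%:R : R).
have := sqrtr_ge0 (n%:R : R).
move: (Num.sqrt i%:R) (Num.sqrt j%:R) (Num.sqrt n%:R) si ei ej en.
move=> x y z si ei ej en z0 y0 x0.
(* After squaring, the claim reads [25 / 16 * n <= n + 2 * x * y]; it holds because [x * y >= i] and
   [n <= 2 * i + 1 <= 3 * i]. *)
rewrite -ler_sqr ?nnegrE; [|nra|nra].
nra.
Qed.

(** The induction needs the stronger bound [K ^+ 2 * (n - sqrt n / 2)]: on splitting [n] in halves,
    the subtracted roots gain [K ^+ 2 / 8 * sqrt n], which pays for the error
    [c + 2 * k * K * sqrt n]. *)
Lemma nearly_additive_linear_bound v c : 0 <= c -> (forall n, 0 <= v n) ->
  (forall i j, v (i + j)%N <= v i + v j + c + 2 * Num.sqrt (c * (v i + v j))) ->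
  exists C, 0 <= C /\ forall n, (0 < n)%N -> v n <= C * n%:R.
Proof.
move=> c0 v0 vD.
(* The factor 17 gives [k ^+ 2 + 2 * k * K <= K ^+ 2 / 8], and the second term gives
   [v 1 <= K ^+ 2 / 2], which is the case [n = 1]. *)
pose k := Num.sqrt c; pose K := 17 * k + Num.sqrt (2 * v 1%N).
have k0 : 0 <= k by exact: sqrtr_ge0.
have kc : k ^+ 2 = c by rewrite sqr_sqrtr.
have s0 : 0 <= Num.sqrt (2 * v 1%N) by exact: sqrtr_ge0.
have sE : Num.sqrt (2 * v 1%N) ^+ 2 = 2 * v 1%N.
  by rewrite sqr_sqrtr// mulr_ge0.
have K0 : 17 * k <= K by rewrite /K; lra.
have K1 : 2 * v 1%N <= K ^+ 2 by rewrite /K; nra.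
have KK : k ^+ 2 + 2 * k * K <= K ^+ 2 / 8 by nra.
have H n : (0 < n)%N -> v n <= K ^+ 2 * n%:R - K ^+ 2 / 2 * Num.sqrt n%:R.
  elim/ltn_ind: n => n IH n0.
  have [->|n1] := eqVneq n 1%N; first by rewrite sqrtr1; lra.
  have {}n1 : (1 < n)%N by lia.
  have hs := sqrt_half_split n1.
  have i0 : (0 < n./2)%N by lia.
  have j0 : (0 < n - n./2)%N by lia.
  have nij : n%:R = (n./2)%:R + (n - n./2)%N%:R :> R.
    by rewrite -natrD; congr (_%:R); lia.
  have := vD (n./2) (n - n./2)%N.
  have -> : (n./2 + (n - n./2))%N = n by lia.
  have := IH n./2 ltac:(lia) i0; have := IH (n - n./2)%N ltac:(lia) j0.
  have /= := v0 (n./2); have /= := v0 (n - n./2)%N.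
  move: (v n./2) (v (n - n./2)%N) => vi vj vj0 vi0 hj hi hn.
  have sum_le : vi + vj <= K ^+ 2 * n%:R.
    have := sqrtr_ge0 ((n./2)%:R : R); have := sqrtr_ge0 ((n - n./2)%N%:R : R).
    by rewrite nij; nra.
  have sq : Num.sqrt (c * (vi + vj)) <= k * K * Num.sqrt n%:R.
    have k3 : 0 <= k * K * Num.sqrt n%:R.
      by rewrite mulr_ge0 ?sqrtr_ge0// mulr_ge0//; lra.
    rewrite -(ger0_norm k3) -sqrtr_sqr.
    rewrite ler_sqrt ?sqr_ge0//.
    rewrite !exprMn kc sqr_sqrtr ?ler0n// -mulrA.
    by rewrite ler_wpM2l.
  have n1R : 1 <= Num.sqrt n%:R :> R.
    by rewrite -[leLHS]sqrtr1 ler_sqrt ?ler0n// ler1n.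
  move: (Num.sqrt (c * _)) sq hn => e sq hn.
  move: (Num.sqrt n%:R) (Num.sqrt n./2%:R) (Num.sqrt (n - n./2)%N%:R)
    hs hi hj sq n1R => x y z.
  rewrite nij => hs hi hj sq n1R.
  have z0 : 0 <= x by lra.
  have h1 : 0 <= K ^+ 2 * (y + z - 5 / 4 * x) by rewrite mulr_ge0 ?sqr_ge0//; lra.
  have h2 : 0 <= c * (x - 1) by rewrite mulr_ge0//; lra.
  have h3 : 0 <= x * (K ^+ 2 / 8 - k ^+ 2 - 2 * k * K) by rewrite mulr_ge0//; lra.
  rewrite kc in h3; nra.
exists (K ^+ 2); split => [|n n0]; first exact: sqr_ge0.
apply: (le_trans (H _ n0)); rewrite gerBl mulr_ge0 ?sqrtr_ge0//.
by rewrite divr_ge0 ?sqr_ge0.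
Qed.

(** Induction on [k] by halving. The bound vanishes at [k = 1], and the factor 4 turns the gain of
    [sqrt k / 4] in the subtracted roots into exactly the error of one splitting. *)
Lemma nearly_additive_multiple v c : 0 <= c ->
  (forall i j, (0 < i)%N -> (0 < j)%N ->
    `|v (i + j)%N - v i - v j| <= c * Num.sqrt (i + j)%N%:R) ->
  forall k m, (0 < k)%N -> (0 < m)%N ->
    `|v (k * m)%N - k%:R * v m| <=
      4 * c * Num.sqrt m%:R * (k%:R - Num.sqrt k%:R).
Proof.
move=> c0 vD k m k0 m0; elim/ltn_ind: k k0 => k IH k0.
have [->|k1] := eqVneq k 1%N.
  by rewrite mul1n mul1r sqrtr1 !subrr normr0 mulr0.
have {}k1 : (1 < k)%N by lia.
have hs := sqrt_half_split k1.
have i0 : (0 < k./2)%N by lia.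
have j0 : (0 < k - k./2)%N by lia.
have := IH (k./2) ltac:(lia) i0.
have := IH (k - k./2)%N ltac:(lia) j0.
have := vD (k./2 * m)%N ((k - k./2) * m)%N ltac:(lia) ltac:(lia).
rewrite -mulnDl.
have -> : (k./2 + (k - k./2))%N = k by lia.
have kij : k%:R = (k./2)%:R + (k - k./2)%N%:R :> R.
  by rewrite -natrD; congr (_%:R); lia.
rewrite natrM sqrtrM ?ler0n//.
move: (v (k * m)%N) (v (k./2 * m)%N) (v ((k - k./2) * m)%N) (v m) => a b d e.
have := sqrtr_ge0 (m%:R : R).
move: (Num.sqrt k%:R) (Num.sqrt k./2%:R) (Num.sqrt (k - k./2)%N%:R)
  (Num.sqrt m%:R) hs => x y z t hs t0.
rewrite kij !ler_norml => /andP[h1 h2] /andP[h3 h4] /andP[h5 h6].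
have h7 : 0 <= (c * t) * (4 * (y + z - 5 / 4 * x)).
  by rewrite mulr_ge0//; [exact: mulr_ge0 | lra].
by apply/andP; split; nra.
Qed.

(** Both [v m / m] and [v n / n] are compared with [v (m * n) / (m * n)], at a cost of
    [4 * c / sqrt m] and [4 * c / sqrt n]; the sequence is therefore Cauchy. *)
Lemma nearly_additive_cvg v c : 0 <= c ->
  (forall i j, (0 < i)%N -> (0 < j)%N ->
    `|v (i + j)%N - v i - v j| <= c * Num.sqrt (i + j)%N%:R) ->
  cvgn (fun n => n%:R^-1 * v n).
Proof.
move=> c0 vD.
have close m n : (0 < m)%N -> (m <= n)%N ->
    `|m%:R^-1 * v m - n%:R^-1 * v n| <= 8 * c / Num.sqrt m%:R.
  move=> m0 mn; have n0 : (0 < n)%N by exact: leq_trans mn.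
  have hk := nearly_additive_multiple c0 vD n0 m0.
  have hm := nearly_additive_multiple c0 vD m0 n0.
  rewrite mulnC in hm.
  have mR : 0 < m%:R :> R by rewrite ltr0n.
  have nR : 0 < n%:R :> R by rewrite ltr0n.
  have sm0 : 0 < Num.sqrt m%:R :> R by rewrite sqrtr_gt0.
  have sn0 : 0 < Num.sqrt n%:R :> R by rewrite sqrtr_gt0.
  have smn : Num.sqrt m%:R <= Num.sqrt n%:R :> R by rewrite ler_sqrt ?ler_nat// ltW.
  have -> : m%:R^-1 * v m - n%:R^-1 * v n =
      (n%:R * v m - m%:R * v n) / (n%:R * m%:R).
    by field; rewrite !gt_eqF.
  rewrite normrM [`|_^-1|]gtr0_norm ?invr_gt0 ?mulr_gt0//.
  rewrite ler_pdivrMr ?mulr_gt0//.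
  have em : Num.sqrt m%:R ^+ 2 = m%:R :> R by rewrite sqr_sqrtr// ltW.
  have en : Num.sqrt n%:R ^+ 2 = n%:R :> R by rewrite sqr_sqrtr// ltW.
  move: (Num.sqrt m%:R) (Num.sqrt n%:R) sm0 sn0 smn em en hk hm.
  move=> x y x0 y0 xy <- <-.
  have -> : 8 * c / x * (y ^+ 2 * x ^+ 2) = 8 * c * x * y ^+ 2.
    by field; rewrite gt_eqF.
  move: (v _) => w; move: (v _) (v _) => a b.
  rewrite !ler_norml => /andP[h1 h2] /andP[h3 h4].
  have h5 : 0 <= c * x * y by rewrite mulr_ge0 ?(ltW y0)// mulr_ge0// ltW.
  have h6 : 0 <= c * x * y * (y - x) by rewrite mulr_ge0// subr_ge0.
  by apply/andP; split; nra.
apply: cauchy_cvg.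
apply: cauchy_exP => e e0.
pose N := (Num.truncn ((8 * c / e) ^+ 2)).+1.
exists (N%:R^-1 * v N).
exists N => //= n /= Nn; apply: le_lt_trans (close _ _ _ Nn) _ => //.
have : (8 * c / e) ^+ 2 < N%:R by exact: truncnS_gt.
have NR : 0 < N%:R :> R by rewrite ltr0n.
have sN0 : 0 < Num.sqrt N%:R :> R by rewrite sqrtr_gt0.
rewrite -{1}(sqr_sqrtr (ltW NR)) ltr_sqr ?nnegrE ?(ltW sN0)//; last first.
  by rewrite divr_ge0 ?(ltW e0)// mulr_ge0.
by rewrite !ltr_pdivrMr// [in X in _ -> X](mulrC e).
Qed.

(** The linear bound [v n <= C * n] turns the error, which depends on [v], into a multiple of
    [sqrt (i + j)]. *)
Lemma nearly_additive_sqrt_cvg v c : 0 <= c -> (forall n, 0 <= v n) ->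
  (forall i j,
    `|v (i + j)%N - v i - v j| <= c + 2 * Num.sqrt (c * (v i + v j))) ->
  cvgn (fun n => n%:R^-1 * v n).
Proof.
move=> c0 v0 vD.
have [|C [C0 vC]] := nearly_additive_linear_bound c0 v0.
  by move=> i j; have := vD i j; rewrite ler_norml => /andP[_]; lra.
apply: (@nearly_additive_cvg _ (c + 2 * Num.sqrt (c * C))).
  by rewrite addr_ge0// mulr_ge0// sqrtr_ge0.
move=> i j i0 j0; apply: (le_trans (vD i j)).
rewrite [leRHS]mulrDl lerD//.
  by rewrite ler_peMr// -[leLHS]sqrtr1 ler_sqrt ?ler0n// ler1n addn_gt0 i0.
rewrite -mulrA ler_wpM2l// -sqrtrM ?mulr_ge0//.
rewrite ler_sqrt ?mulr_ge0 ?ler0n//.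
by rewrite -mulrA ler_wpM2l// natrD mulrDr lerD// vC.
Qed.

(** If all increments after [N] were below [c / 2], then [a] would grow with slope at most [c / 2],
    and so fall below the line of slope [c]. *)
Lemma increments_frequently_large (a : nat -> R) c :
  0 < c -> (\forall n \near \oo, c * n%:R <= a n) ->
  forall N, exists n, (N <= n)%N /\ c / 2 <= a n.+1 - a n.
Proof.
move=> c0 [M _ aM] N; apply: contrapT => noinc.
have inc n : (N <= n)%N -> a n.+1 - a n < c / 2.
  by move=> Nn; rewrite ltNge; apply/negP => h; apply: noinc; exists n.
have lin k : a (N + k)%N <= a N + c / 2 * k%:R.
  elim: k => [|k IH]; first by rewrite addn0 mulr0 addr0.
  rewrite addnS; have := inc (N + k)%N (leq_addr _ _).
  by rewrite -(natr1 k); lra.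
pose k := (M + (Num.truncn (2 * `|a N| / c)).+1)%N.
have := aM (N + k)%N; rewrite /= => /(_ ltac:(lia)).
have := lin k; rewrite natrD.
have : 2 * `|a N| / c < k%:R.
  by apply: (lt_le_trans (truncnS_gt _)); rewrite ler_nat leq_addl.
rewrite ltr_pdivrMr// => h1 h2 h3.
have h4 : 0 <= c * N%:R by rewrite mulr_ge0// ltW.
have := ler_norm (a N); nra.
Qed.

End nearly_additive.

(** * Square-integrable random variables *)

Section square_integrable.
Context d (T : measurableType d) (R : realType) (P : probability T R).

Lemma Lfun_measurable p (f : T -> R) : f \in Lfun P p -> measurable_fun setT f.
Proof. by rewrite inE => /andP[]; rewrite inE. Qed.

(** Links the hypotheses, which bound expectations of squares, to the membership in [Lfun] that the
    covariance lemmas ask for. *)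
Lemma Lfun2E (f : T -> R) : measurable_fun setT f ->
  (f \in Lfun P 2%:E) = ('E_P[fun x => (`|f x| ^+ 2)%R] < +oo)%E.
Proof.
move=> mf.
have -> : ('E_P[fun x => (`|f x| ^+ 2)%R] =
    \int[P]_x (`|(EFin \o f) x| `^ 2))%E.
  rewrite unlock; apply: eq_integral => x _ /=.
  by rewrite powR_mulrn.
apply/idP/idP.
  rewrite inE => /andP[_]; rewrite inE /= /finite_norm unlock.
  by apply: lty_poweRy.
move=> f2; rewrite inE; apply/andP; split; rewrite inE//=.
by rewrite /finite_norm unlock; exact: poweR_lty.
Qed.

Lemma Lfun2_Lfun1 (f : T -> R) : f \in Lfun P 2%:E -> f \in Lfun P 1.
Proof. by apply: Lfun_subset12; rewrite fin_num_measure. Qed.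

Lemma Lfun2D (f g : T -> R) : f \in Lfun P 2%:E -> g \in Lfun P 2%:E ->
  f \+ g \in Lfun P 2%:E.
Proof. by move=> f2 g2; rewrite rpredD// lee1n. Qed.

Lemma indic_Lfun2 (A : set T) : measurable A -> (\1_A : T -> R) \in Lfun P 2%:E.
Proof.
move=> mA; rewrite Lfun2E//.
have -> : (fun x => `|\1_A x| ^+ 2) = \1_A :> (T -> R).
  apply/funext => x; rewrite indicE.
  by case: (_ \in _); rewrite ?normr0 ?normr1 ?expr0n ?expr1n.
by rewrite expectation_indic// (le_lt_trans (probability_le1 P mA))// ltry.
Qed.

End square_integrable.

(** * Change of variables along a measure-preserving map *)

Section measure_preserving.
Context d1 d2 (T1 : measurableType d1) (T2 : measurableType d2) (R : realType).
Context (P1 : probability T1 R) (P2 : probability T2 R) (phi : {mfun T1 >-> T2}).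
Hypothesis P12 : forall A, measurable A -> distribution P1 phi A = P2 A.

Lemma ge0_expectation_preserving (f : T2 -> R) : measurable_fun setT f ->
  (forall x, 0 <= f x) -> ('E_P2[f] = 'E_P1[f \o phi])%E.
Proof.
move=> mf f0; rewrite unlock.
transitivity (\int[distribution P1 phi]_x (f x)%:E)%E.
  by apply: eq_measure_integral => A mA _; exact/esym/P12.
by rewrite ge0_integral_distribution//; exact/measurable_EFinP.
Qed.

(** The nonnegative case applied to [|f|]; the formula for signed functions relies on this
    integrability. *)
Lemma Lfun1_preserving (f : T2 -> R) :
  f \in Lfun P2 1 -> f \o phi \in Lfun P1 1.
Proof.
move=> f1; have mf := Lfun_measurable f1.
move/Lfun1_integrable/integrableP : f1 => [_ f1].
apply/Lfun1_integrable/integrableP; split.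
  exact/measurable_EFinP/measurableT_comp.
apply: le_lt_trans f1.
have := @ge0_expectation_preserving (fun x => `|f x|) _ (fun=> normr_ge0 _).
rewrite unlock => ->//; exact: measurableT_comp.
Qed.

Lemma expectation_preserving (f : T2 -> R) :
  f \in Lfun P2 1 -> ('E_P2[f] = 'E_P1[f \o phi])%E.
Proof.
move=> f1; have mf := Lfun_measurable f1.
rewrite unlock.
transitivity (\int[distribution P1 phi]_x (f x)%:E)%E.
  by apply: eq_measure_integral => A mA _; exact/esym/P12.
rewrite integral_distribution//; first exact/measurable_EFinP.
exact/Lfun1_integrable/Lfun1_preserving.
Qed.

Lemma Lfun2_preserving (f : T2 -> R) :
  f \in Lfun P2 2%:E -> f \o phi \in Lfun P1 2%:E.
Proof.
move=> f2; have mf := Lfun_measurable f2.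
rewrite Lfun2E; last exact: measurableT_comp.
move: f2; rewrite Lfun2E// (@ge0_expectation_preserving (fun x => `|f x| ^+ 2))//.
by apply: measurable_funX; exact: measurableT_comp.
Qed.

Lemma variance_preserving (f : T2 -> R) :
  f \in Lfun P2 2%:E -> ('V_P2[f] = 'V_P1[f \o phi])%E.
Proof.
move=> f2; have f2' := Lfun2_preserving f2.
rewrite !varianceE// -expectation_preserving; last exact: Lfun2_Lfun1.
by rewrite expectation_preserving//; exact: (Lfun2_mul_Lfun1 f2 f2).
Qed.

End measure_preserving.

(** * Expectation of a product of independent factors *)

Section product_of_functions.
Context d1 d2 (T1 : measurableType d1) (T2 : measurableType d2) (R : realType).
Context (P1 : probability T1 R) (P2 : probability T2 R).

(** Fubini. In its applications, the joint integrability is transported from a product of two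
    square-integrable functions. *)
Lemma expectation_product (a : T1 -> R) (b : T2 -> R) :
  a \in Lfun P1 1 -> b \in Lfun P2 1 ->
  (fun z => a z.1 * b z.2) \in Lfun (P1 \x P2)%E 1 ->
  ('E_((P1 \x P2)%E)[fun z => (a z.1 * b z.2)%R] = 'E_P1[a] * 'E_P2[b])%E.
Proof.
move=> a1 b1 /Lfun1_integrable ab1; rewrite unlock -integral12_prod_meas1//.
rewrite /fubini_F /=.
have /Lfun1_integrable ia := a1; have /Lfun1_integrable ib := b1.
under eq_integral => x _.
  under eq_integral do rewrite EFinM.
  rewrite integralZl//.
  over.
rewrite -(fineK (integrable_fin_num _ ib))//.
by rewrite integralZr.
Qed.

End product_of_functions.

(** * Covariance inequalities and sums *)

Section real_moments.
Context d (T : measurableType d) (R : realType) (P : probability T R).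
Implicit Types X Y Z : T -> R.

Lemma covariance_fineK X Y : X \in Lfun P 2%:E -> Y \in Lfun P 2%:E ->
  (fine (covariance P X Y))%:E = covariance P X Y.
Proof.
move=> X2 Y2; rewrite fineK// covariance_fin_num//; try exact: Lfun2_Lfun1.
exact: Lfun2_mul_Lfun1.
Qed.

(** Cauchy-Schwarz: the one-sided bound [covariance_le], applied to [X] and to [\- X], controls the
    absolute value. *)
Lemma sqr_covariance_le X Y : X \in Lfun P 2%:E -> Y \in Lfun P 2%:E ->
  fine (covariance P X Y) ^+ 2 <= fine 'V_P[X]%E * fine 'V_P[Y]%E.
Proof.
move=> X2 Y2.
have vX : 0 <= fine 'V_P[X]%E by rewrite fine_ge0// variance_ge0.
have vY : 0 <= fine 'V_P[Y]%E by rewrite fine_ge0// variance_ge0.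
have le_sqrt Z : Z \in Lfun P 2%:E ->
    fine (covariance P Z Y) <= Num.sqrt (fine 'V_P[Z]%E * fine 'V_P[Y]%E).
  move=> Z2; rewrite -lee_fin covariance_fineK// sqrtrM ?fine_ge0 ?variance_ge0//.
  have := covariance_le Z2 Y2.
  by rewrite -{1}(fineK (variance_fin_num Z2)) -{1}(fineK (variance_fin_num Y2)).
have XN2 : (\- X) \in Lfun P 2%:E by rewrite rpredN.
have := le_sqrt _ X2; have := le_sqrt _ XN2.
rewrite varianceN// covarianceNl; try exact: Lfun2_Lfun1; last first.
  exact: Lfun2_mul_Lfun1.
rewrite fineN => h1 h2.
rewrite -[leRHS]sqr_sqrtr ?mulr_ge0//.
rewrite -ler_sqrt ?sqr_ge0// !sqrtr_sqr [leRHS]ger0_norm ?sqrtr_ge0//.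
by rewrite ler_norml h2 andbT lerNl.
Qed.

Lemma variance_le_expectation_sqr X : X \in Lfun P 2%:E ->
  ('V_P[X] <= 'E_P[fun x => (`|X x| ^+ 2)%R])%E.
Proof.
move=> X2; rewrite varianceE//.
have -> : (fun x => `|X x| ^+ 2) = X ^+ 2.
  by apply/funext => x; rewrite real_normK ?num_real.
by rewrite leeBlDr ?fin_numX ?expectation_fin_num ?Lfun2_Lfun1// leeDl// sqre_ge0.
Qed.

Lemma sqr_expectation_le X : X \in Lfun P 2%:E ->
  (('E_P[X]) ^+ 2 <= 'E_P[fun x => (`|X x| ^+ 2)%R])%E.
Proof.
move=> X2; have := variance_ge0 P X; rewrite varianceE//.
have -> : (fun x => `|X x| ^+ 2) = X ^+ 2.
  by apply/funext => x; rewrite real_normK ?num_real.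
rewrite sube_ge0; first by [].
by rewrite fin_numX//; exact/expectation_fin_num/Lfun2_Lfun1.
Qed.

(** As [X] and [Y] are uncorrelated, the error is [V[Z] + 2 Cov(X + Y, Z)]; here [V[Z] <= tau], and
    Cauchy-Schwarz bounds the covariance. *)
Lemma variance_near_additive X Y Z (tau : R) :
  X \in Lfun P 2%:E -> Y \in Lfun P 2%:E -> Z \in Lfun P 2%:E ->
  covariance P X Y = 0%E -> ('E_P[fun x => (`|Z x| ^+ 2)%R] <= tau%:E)%E ->
  `|fine 'V_P[(X \+ Y \+ Z)%R]%E - fine 'V_P[X]%E - fine 'V_P[Y]%E| <=
    tau + 2 * Num.sqrt (tau * (fine 'V_P[X]%E + fine 'V_P[Y]%E)).
Proof.
move=> X2 Y2 Z2 XY0 Ztau.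
have XY2 : (X \+ Y) \in Lfun P 2%:E by rewrite rpredD// lee1n.
have vXY : ('V_P[(X \+ Y)%R] = (fine 'V_P[X] + fine 'V_P[Y])%:E)%E.
  by rewrite varianceD// XY0 mule0 adde0 EFinD !fineK// variance_fin_num.
have vZ : fine 'V_P[Z]%E <= tau.
  rewrite -lee_fin fineK ?variance_fin_num//.
  exact: le_trans (variance_le_expectation_sqr Z2) Ztau.
have := sqr_covariance_le XY2 Z2.
rewrite (varianceD XY2 Z2) vXY -(covariance_fineK XY2 Z2).
rewrite -(fineK (variance_fin_num Z2)) -EFinM -!EFinD /=.
have vX0 : 0 <= fine 'V_P[X]%E by rewrite fine_ge0// variance_ge0.
have vY0 : 0 <= fine 'V_P[Y]%E by rewrite fine_ge0// variance_ge0.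
have vZ0 : 0 <= fine 'V_P[Z]%E by rewrite fine_ge0// variance_ge0.
move: (fine _) (fine 'V_P[X]%E) (fine 'V_P[Y]%E) (fine 'V_P[Z]%E) vX0 vY0 vZ0 vZ.
move=> c x y z x0 y0 z0 ztau cle.
have : `|c| <= Num.sqrt (tau * (x + y)).
  rewrite -sqrtr_sqr ler_sqrt; last first.
    by rewrite mulr_ge0 ?addr_ge0//; exact: le_trans z0 ztau.
  by apply: (le_trans cle); rewrite mulrC ler_wpM2r// addr_ge0.
by rewrite !ler_norml => /andP[h1 h2]; apply/andP; split; lra.
Qed.

(** The two claims go together: additivity of the covariance at each step uses the square
    integrability of the partial sum. *)
Lemma covariance_suml n (X : nat -> T -> R) Y :
  (forall k, X k \in Lfun P 2%:E) -> Y \in Lfun P 2%:E ->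
  (fun w => \sum_(k < n) X k w) \in Lfun P 2%:E /\
  (covariance P (fun w => (\sum_(k < n) X k w)%R) Y =
    \sum_(k < n) covariance P (X k) Y)%E.
Proof.
move=> X2 Y2; elim: n => [|n [IH1 IH2]].
  have -> : (fun w => \sum_(k < 0) X k w) = cst 0.
    by apply/funext => w; rewrite big_ord0.
  by rewrite Lfun_cst covariance_cst_l big_ord0.
have -> : (fun w => \sum_(k < n.+1) X k w) = (fun w => \sum_(k < n) X k w) \+ X n.
  by apply/funext => w; rewrite big_ord_recr.
by rewrite rpredD ?lee1n// covarianceDl// IH2 big_ord_recr.
Qed.

Lemma expectation_sum_ord n (X : nat -> T -> R) :
  (forall k, X k \in Lfun P 1) ->
  (fun w => \sum_(k < n) X k w) \in Lfun P 1 /\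
  ('E_P[fun w => (\sum_(k < n) X k w)%R] = \sum_(k < n) 'E_P[X k])%E.
Proof.
move=> X1; elim: n => [|n [IH1 IH2]].
  have -> : (fun w => \sum_(k < 0) X k w) = cst 0.
    by apply/funext => w; rewrite big_ord0.
  by rewrite Lfun_cst expectation_cst big_ord0.
have -> : (fun w => \sum_(k < n.+1) X k w) = (fun w => \sum_(k < n) X k w) \+ X n.
  by apply/funext => w; rewrite big_ord_recr.
by rewrite rpredD// expectationD// IH2 big_ord_recr.
Qed.

End real_moments.

(** * The product measure under concatenation, insertion and shift *)

Section sequence_space.
Context (d : measure_display) (G : measurableType d).

Lemma measurable_coord (i : nat) :
  measurable_fun [set: Omega G] (fun w : Omega G => w i).
Proof.
by move=> _ B mB; apply: sub_sigma_algebra; exists i => //; exists B.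
Qed.

Lemma measurable_fun_coord d' (T : measurableType d') (f : T -> Omega G) :
  (forall i, measurable_fun setT (fun x => f x i)) -> measurable_fun setT f.
Proof.
move=> mf; apply: (@measurability _ _ T (Omega G) setT f (@coord_sets d G)) => //.
move=> _ [_ [i _ [B mB <-]] <-].
by have := mf i measurableT _ mB; rewrite !setTI.
Qed.

Definition box (n : nat) (B : nat -> set G) : set (Omega G) :=
  [set w | forall i, (i < n)%N -> B i (w i)].

Lemma measurable_box n B : (forall i, measurable (B i)) -> measurable (box n B).
Proof.
move=> mB; have -> : box n B =
    \bigcap_(i in [set i | (i < n)%N]) ((fun w : Omega G => w i) @^-1` B i) by [].
apply: bigcap_measurableType => i _.
by have := measurable_coord i measurableT (mB i); rewrite setTI.
Qed.

Lemma measurable_shift n : measurable_fun [set: Omega G] (@shift _ G n).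
Proof. by apply: measurable_fun_coord => i; exact: measurable_coord. Qed.

HB.instance Definition _ n :=
  isMeasurableFun.Build _ _ _ _ (@shift _ G n) (measurable_shift n).

(** Realises [P] as an image of [P \x P], where the first [n] entries and the shifted sequence are
    independent by construction. *)
Definition concat n (z : Omega G * Omega G) : Omega G :=
  fun i => if (i < n)%N then z.1 i else z.2 (i - n)%N.

Lemma measurable_concat n : measurable_fun setT (concat n).
Proof.
apply: measurable_fun_coord => i; rewrite /concat; case: (i < n)%N.
- apply: (@measurableT_comp _ _ _ _ _ _ (fun w : Omega G => w i) setT fst) => //.
  exact: measurable_coord.
- apply: (@measurableT_comp _ _ _ _ _ _ (fun w : Omega G => w (i - n)%N) setT snd) => //.
  exact: measurable_coord.
Qed.

HB.instance Definition _ n :=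
  isMeasurableFun.Build _ _ _ _ (concat n) (measurable_concat n).

(** A section of [remove k]: the entry at [k] and the remaining sequence become separate,
    independent variables. *)
Definition insert k (z : G * Omega G) : Omega G :=
  fun i => if i == k then z.1 else z.2 (unbump k i).

Lemma measurable_insert k : measurable_fun setT (insert k).
Proof.
apply: measurable_fun_coord => i; rewrite /insert; case: (i == k).
  exact: measurable_fst.
apply: (@measurableT_comp _ _ _ _ _ _ (fun w : Omega G => w (unbump k i)) setT
  (snd : G * Omega G -> Omega G)) => //.
exact: measurable_coord.
Qed.

HB.instance Definition _ k :=
  isMeasurableFun.Build _ _ _ _ (insert k) (measurable_insert k).

Lemma shift_concat n z : shift n (concat n z) = z.2.
Proof.
by apply/funext => i; rewrite /shift /concat ltnNge leq_addr /= addKn.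
Qed.

Lemma prefix_concat n z : prefix n (concat n z) = prefix n z.1.
Proof.
by apply: eq_from_tnth => i; rewrite !tnth_mktuple /concat ltn_ord.
Qed.

Lemma remove_insert k z : remove k (insert k z) = z.2.
Proof.
apply/funext => i; rewrite /remove /insert bumpK.
by rewrite eq_sym (negbTE (neq_bump _ _)).
Qed.

Context (R : realType) (mu : probability G R) (P : probability (Omega G) R).
Hypothesis hP : is_product_measure mu P.

Lemma measure_box n B : (forall i, measurable (B i)) ->
  P (box n B) = (\prod_(i < n) mu (B i))%E.
Proof. exact: hP. Qed.

(** Boxes of length at least [N] still form a generating pi-system, since shorter ones can be padded
    with [setT]. The threshold ensures that a box reaches past the cut of [concat] or the place used
    by [insert]. *)
Lemma boxes_determine_measure (P' : probability (Omega G) R) N :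
  (forall n B, (N <= n)%N -> (forall i, measurable (B i)) ->
    P' (box n B) = (\prod_(i < n) mu (B i))%E) ->
  forall A, measurable A -> P' A = P A.
Proof.
move=> hP' A mA.
pose boxes := [set A | exists n B,
  [/\ (N <= n)%N, forall i, measurable (B i) & A = box n B]].
apply: (measure_unique boxes (fun=> setT)) => //.
- apply/seteqP; split.
    apply: smallest_sub.
      by split; [exact: sigma_algebra0 | move=> ? ?; exact: sigma_algebraCD
        | exact: sigma_algebra_bigcup].
    move=> _ [i _ [B mB <-]]; apply: sub_sigma_algebra.
    exists (maxn N i.+1), (fun j => if j == i then B else setT).
    split; [by rewrite leq_maxl | by move=> j; case: ifP | ].
    rewrite setTI; apply/seteqP; split => w /=.
      by move=> Bw j _; case: ifP => [/eqP ->|].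
    by move/(_ i); rewrite eqxx; apply; rewrite leq_max leqnn orbT.
  apply: smallest_sub; first exact: sigma_algebra_measurable.
  by move=> _ [n [B [_ mB ->]]]; exact: measurable_box.
- move=> _ _ [n [B [Nn mB ->]]] [m [C [Nm mC ->]]].
  exists (maxn n m), (fun i => (if (i < n)%N then B i else setT) `&`
                               (if (i < m)%N then C i else setT)).
  split; first by rewrite leq_max Nn.
    by move=> i; apply: measurableI; case: ifP.
  apply/seteqP; split => w /=.
    by move=> [Bw Cw] i _; split; case: ifP => // h; [exact: Bw|exact: Cw].
  move=> BCw; split => i ni.
    by have := BCw i; rewrite leq_max ni => /(_ isT)[].
  by have := BCw i; rewrite leq_max ni orbT => /(_ isT)[].
- by move=> _; exists N, (fun=> setT); split => //; apply/seteqP; split.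
- by rewrite bigcup_const.
- move=> _ [n [B [Nn mB ->]]].
  by apply: (etrans (hP' n B Nn mB)); exact/esym/measure_box.
- by move=> _; apply: (le_lt_trans (probability_le1 P' measurableT)); rewrite ltry.
Qed.

(** The preimage of a box of length [n + m] is a rectangle of two boxes, and the product of the
    measures of the sides splits accordingly. *)
Lemma concat_preserving n A : measurable A ->
  distribution (P \x P)%E (concat n) A = P A.
Proof.
apply: (@boxes_determine_measure (distribution (P \x P)%E (concat n)) n).
move=> m B /subnKC <-; move: (m - n)%N => {}m mB.
have E : concat n @^-1` box (n + m) B = box n B `*` box m (fun i => B (n + i)%N).
  apply/seteqP; split => [z /= zB|z /= [zB zB'] i im].
    split => i im.
      by have := zB i (ltn_addr _ im); rewrite /concat im.
    have := zB (n + i)%N; rewrite ltn_add2l.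
    by rewrite -[concat n z _]/(shift n (concat n z) i) shift_concat; exact.
  rewrite /concat; case: ltnP => [|ni]; first exact: zB.
  by rewrite -{1}(subnKC ni); apply: zB'; lia.
rewrite -[LHS]/((P \x P)%E (concat n @^-1` box (n + m) B)) E.
rewrite product_measure1E//; [|exact: measurable_box..].
rewrite big_split_ord /=; congr (_ * _)%E; exact: measure_box.
Qed.

(** The preimage of a box reaching past [k] is the side [B k] times the box of the other sides, so
    the factor [mu (B k)] splits off. *)
Lemma insert_preserving k A : measurable A ->
  distribution (mu \x P)%E (insert k) A = P A.
Proof.
apply: (@boxes_determine_measure (distribution (mu \x P)%E (insert k)) k.+1).
move=> [//|n] B kn mB; rewrite /distribution /pushforward.
have E : insert k @^-1` box n.+1 B = B k `*` box n (fun i => B (bump k i)).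
  apply/seteqP; split => [z /= zB|z /= [zB zB'] i im].
    split; first by have := zB k kn; rewrite /insert eqxx.
    move=> i im; have := zB (bump k i).
    rewrite /insert bumpK eq_sym (negbTE (neq_bump _ _)); apply.
    by rewrite /bump; case: (k <= i)%N; lia.
  rewrite /insert; case: eqVneq => [->//|ik].
  have {1}-> : i = bump k (unbump k i) by rewrite unbumpKcond (negbTE ik).
  by apply: zB'; rewrite /unbump; move: ik im kn; case: (ltnP k i); lia.
rewrite -[LHS]/((mu \x P)%E (insert k @^-1` box n.+1 B)) E.
rewrite product_measure1E//; [|exact: measurable_box].
rewrite (bigD1_ord (Ordinal kn))//=; congr (_ * _)%E; exact: measure_box.
Qed.

(** After [concat n], the shift is the second projection of [P \x P]. *)
Lemma shift_preserving n A : measurable A -> distribution P (@shift _ G n) A = P A.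
Proof.
move=> mA; rewrite /distribution /pushforward.
have mS : measurable (@shift _ G n @^-1` A).
  by rewrite -[X in measurable X]setTI; exact: measurable_shift.
rewrite -(concat_preserving n mS) /distribution /pushforward.
have E : concat n @^-1` (shift n @^-1` A) = setT `*` A.
  by apply/seteqP; split => z /=; rewrite shift_concat => //; case.
rewrite -[LHS]/((P \x P)%E (concat n @^-1` (shift n @^-1` A))) E.
rewrite product_measure1E//.
by rewrite -[LHS]/(P setT * P A)%E probability_setT mul1e.
Qed.

End sequence_space.

Section cocycle.
Context (d : measure_display) (G : measurableType d) (R : realType).
Context (mu : probability G R) (P : probability (Omega G) R).
Hypothesis hP : is_product_measure mu P.

(** * Moments of the cocycle and their asymptotics *)

Section adapted.
Variable Q : nat -> Omega G -> R.
Variable g : forall n : nat, n.-tuple G -> R.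
Hypothesis mg : forall n, measurable_fun [set: n.-tuple G] (g (n:=n)).
Hypothesis Qg : forall n w, Q n w = g (prefix n w).

Lemma measurable_cocycle n : measurable_fun setT (Q n).
Proof.
have -> : Q n = @g n \o @prefix _ G n by apply/funext => w; exact: Qg.
apply: (measurableT_comp (@mg n)); apply: (measurable_fun_tnthP _).2 => i.
have -> : (@tnth n G)^~ i \o prefix n = (fun w : Omega G => w i).
  by apply/funext => w /=; rewrite tnth_mktuple.
exact: measurable_coord.
Qed.

Lemma cocycle_concat n z : Q n (concat n z) = Q n z.1.
Proof. by rewrite !Qg prefix_concat. Qed.

Hypothesis Q0 : forall w, Q 0%N w = 0.
Hypothesis hQ2 : finite_second_moment P Q.
Variable tau : R.
Hypothesis hdev : forall n m,
  ('E_P[fun w => (`|defect Q n m w| ^+ 2)%R] <= tau%:E)%E.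

Lemma cocycle_splitE n m :
  Q (n + m)%N = Q n \+ (Q m \o shift n) \+ defect Q n m.
Proof. by apply/funext => w; rewrite /defect /=; ring. Qed.

Lemma defect_Lfun2 n m : defect Q n m \in Lfun P 2%:E.
Proof.
rewrite Lfun2E; first by apply: le_lt_trans (hdev n m) _; rewrite ltry.
have -> : defect Q n m = Q (n + m)%N \- Q n \- (Q m \o shift n) by [].
apply: measurable_funB.
  by apply: measurable_funB; exact: measurable_cocycle.
by apply: measurableT_comp; [exact: measurable_cocycle|exact: measurable_shift].
Qed.

(** Induction on [n]: the new terms are a shifted copy of [Q 1] and a defect, both square
    integrable. *)
Lemma cocycle_Lfun2 n : Q n \in Lfun P 2%:E.
Proof.
elim: n => [|n IH].
  have -> : Q 0%N = cst 0 by apply/funext => w; exact: Q0.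
  exact: Lfun_cst.
have Q1 : Q 1%N \in Lfun P 2%:E by rewrite Lfun2E//; exact: measurable_cocycle.
rewrite -addn1 cocycle_splitE; apply/Lfun2D/defect_Lfun2; apply: Lfun2D => //.
exact: (Lfun2_preserving (shift_preserving hP n) Q1).
Qed.

Lemma cocycle_shift_Lfun2 n m : Q m \o shift n \in Lfun P 2%:E.
Proof. exact: (Lfun2_preserving (shift_preserving hP n) (cocycle_Lfun2 m)). Qed.

(** Pulled back along [concat n], the first factor depends on [z.1] only and the second on [z.2]
    only. *)
Lemma cocycle_shift_uncorrelated n m :
  covariance P (Q n) (Q m \o shift n) = 0%E.
Proof.
have Qn1 := Lfun2_Lfun1 (cocycle_Lfun2 n).
have Qm1 := Lfun2_Lfun1 (cocycle_Lfun2 m).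
have Qs1 := Lfun2_Lfun1 (cocycle_shift_Lfun2 n m).
have QQ1 := Lfun2_mul_Lfun1 (cocycle_Lfun2 n) (cocycle_shift_Lfun2 n m).
rewrite covarianceE//.
have QQE : (Q n * (Q m \o shift n)) \o concat n = (fun z => Q n z.1 * Q m z.2).
  by apply/funext => z /=; rewrite -cocycle_concat -(shift_concat n z).
rewrite (expectation_preserving (concat_preserving hP n) QQ1) QQE.
rewrite -(expectation_preserving (shift_preserving hP n) Qm1).
have := Lfun1_preserving (concat_preserving hP n) QQ1; rewrite QQE => QQ1'.
by rewrite (expectation_product Qn1 Qm1 QQ1') subee// fin_numM// expectation_fin_num.
Qed.

Lemma cocycle_variance_near_additive n m :
  `|fine 'V_P[Q (n + m)%N]%E - fine 'V_P[Q n]%E - fine 'V_P[Q m]%E| <=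
    tau + 2 * Num.sqrt (tau * (fine 'V_P[Q n]%E + fine 'V_P[Q m]%E)).
Proof.
rewrite cocycle_splitE.
rewrite [in 'V_P[Q m]%E](variance_preserving (shift_preserving hP n) (cocycle_Lfun2 m)).
apply: variance_near_additive; last exact: hdev.
- exact: cocycle_Lfun2.
- exact: cocycle_shift_Lfun2.
- exact: defect_Lfun2.
- exact: cocycle_shift_uncorrelated.
Qed.

Lemma deviation_bound_ge0 : 0 <= tau.
Proof.
rewrite -lee_fin; apply: le_trans (hdev 0 0).
by apply: expectation_ge0 => w; exact: sqr_ge0.
Qed.

(** The difference is the mean of the defect, whose square is at most its second moment. *)
Lemma cocycle_expectation_near_additive n m :
  `|fine 'E_P[Q (n + m)%N]%E - fine 'E_P[Q n]%E - fine 'E_P[Q m]%E| <=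
    Num.sqrt tau.
Proof.
have Qn1 := Lfun2_Lfun1 (cocycle_Lfun2 n).
have Qm1 := Lfun2_Lfun1 (cocycle_Lfun2 m).
have Qs1 := Lfun2_Lfun1 (cocycle_shift_Lfun2 n m).
have D1 := Lfun2_Lfun1 (defect_Lfun2 n m).
have -> : ('E_P[Q (n + m)%N] = 'E_P[Q n] + 'E_P[Q m] + 'E_P[defect Q n m])%E.
  rewrite cocycle_splitE (expectationD _ D1) ?rpredD//.
  by rewrite (expectationD Qn1 Qs1) -(expectation_preserving (shift_preserving hP n) Qm1).
have := le_trans (sqr_expectation_le (defect_Lfun2 n m)) (hdev n m).
rewrite -(fineK (expectation_fin_num Qn1)) -(fineK (expectation_fin_num Qm1)).
rewrite -(fineK (expectation_fin_num D1)) -EFin_expe lee_fin /=.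
move: (fine _) (fine _) (fine _) => a b c ctau.
have -> : b + a + c - b - a = c by ring.
by rewrite -sqrtr_sqr ler_sqrt//; exact: deviation_bound_ge0.
Qed.

Lemma cocycle_variance_cvg : cvgn (fun n => n%:R^-1 * fine 'V_P[Q n]%E).
Proof.
apply: (nearly_additive_sqrt_cvg deviation_bound_ge0) => [n|n m].
  by rewrite fine_ge0// variance_ge0.
exact: cocycle_variance_near_additive.
Qed.

Lemma cocycle_expectation_cvg : cvgn (fun n => n%:R^-1 * fine 'E_P[Q n]%E).
Proof.
apply: (nearly_additive_cvg (sqrtr_ge0 tau)) => n m n0 m0.
apply: (le_trans (cocycle_expectation_near_additive n m)).
by rewrite ler_peMr ?sqrtr_ge0// -[leLHS]sqrtr1 ler_sqrt ?ler0n// ler1n addn_gt0 n0.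
Qed.

(** Convergence gives meaning to [limn] and identifies the extended limit with a real one. *)
Lemma asymptotic_varianceE :
  asymptotic_variance P Q = (limn (fun n => n%:R^-1 * fine 'V_P[Q n]%E))%:E.
Proof.
rewrite -EFin_lim; last exact: cocycle_variance_cvg.
congr (limn _); apply/funext => n /=.
by rewrite EFinM fineK// variance_fin_num// cocycle_Lfun2.
Qed.

Lemma driftE : drift P Q = (limn (fun n => n%:R^-1 * fine 'E_P[Q n]%E))%:E.
Proof.
rewrite -EFin_lim; last exact: cocycle_expectation_cvg.
congr (limn _); apply/funext => n /=.
by rewrite EFinM fineK// expectation_fin_num// Lfun2_Lfun1// cocycle_Lfun2.
Qed.

End adapted.

(** * Visits to [A] and their correlation with the cocycle *)

Section visits.
Variables (A : set G) (mA : measurable A).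

Definition visit (k : nat) (w : Omega G) : R := \1_A (w k).
Definition visits (n : nat) (w : Omega G) : R := \sum_(k < n) visit k w.

Lemma visit_Lfun2 k : visit k \in Lfun P 2%:E.
Proof.
have mcA : measurable ((fun w : Omega G => w k) @^-1` A).
  by rewrite -[X in measurable X]setTI; exact: measurable_coord.
exact: (indic_Lfun2 P mcA).
Qed.

(** The entry at [k] is independent of the others, and on a visit [F] depends on the others alone,
    through [h]. This covers the constants, the number of visits and the cocycle. *)
Lemma expectation_visit_mul k (F h : Omega G -> R) :
  F \in Lfun P 2%:E -> h \in Lfun P 1 ->
  (forall z, A z.1 -> F (insert k z) = h z.2) ->
  ('E_P[visit k * F] = mu A * 'E_P[h])%E.
Proof.
move=> F2 h1 Fh.
have VF1 := Lfun2_mul_Lfun1 (visit_Lfun2 k) F2.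
have VFE : (visit k * F) \o insert k = (fun z => (\1_A z.1 : R) * h z.2).
  apply/funext => z /=.
  have -> : (visit k * F) (insert k z) = \1_A z.1 * F (insert k z).
    by rewrite -[LHS]/(\1_A (insert k z k) * F (insert k z)) /insert eqxx.
  rewrite indicE; case: (boolP (z.1 \in A)) => [|_]; last by rewrite !mul0r.
  by rewrite inE => Az; rewrite Fh.
rewrite (expectation_preserving (insert_preserving hP k) VF1) VFE.
have := Lfun1_preserving (insert_preserving hP k) VF1; rewrite VFE => VF1'.
rewrite (expectation_product (Lfun2_Lfun1 (indic_Lfun2 mu mA)) h1 VF1').
by rewrite expectation_indic.
Qed.

Let p := fine (mu A).

Lemma expectation_visit k : ('E_P[visit k] = p%:E)%E.
Proof.
have -> : visit k = visit k * cst 1.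
  by apply/funext => w; rewrite -[RHS]/(visit k w * 1) mulr1.
rewrite (@expectation_visit_mul k (cst 1) (cst 1)) ?Lfun_cst//.
by rewrite expectation_cst mule1 fineK// fin_num_measure.
Qed.

Lemma covariance_visit k (F h : Omega G -> R) :
  F \in Lfun P 2%:E -> h \in Lfun P 1 ->
  (forall z, A z.1 -> F (insert k z) = h z.2) ->
  (covariance P (visit k) F = (p * (fine 'E_P[h] - fine 'E_P[F]))%:E)%E.
Proof.
move=> F2 h1 Fh.
have V2 := visit_Lfun2 k; have F1 := Lfun2_Lfun1 F2.
rewrite covarianceE ?(Lfun2_Lfun1 V2) ?(Lfun2_mul_Lfun1 V2 F2)//.
rewrite (expectation_visit_mul F2 h1 Fh) expectation_visit.
rewrite EFinM EFinB !fineK ?expectation_fin_num ?fin_num_measure//.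
by rewrite muleBr ?fin_num_measure// fin_num_adde_defr ?expectation_fin_num.
Qed.

Lemma visits_Lfun2 n : visits n \in Lfun P 2%:E.
Proof. by have [] := covariance_suml n visit_Lfun2 (visit_Lfun2 0). Qed.

Lemma visits_insert n k z : (k <= n)%N -> A z.1 ->
  visits n.+1 (insert k z) = 1 + visits n z.2.
Proof.
move=> kn Az; rewrite /visits (bigD1_ord (Ordinal (kn : (k < n.+1)%N)))//=.
congr (_ + _); first by rewrite /visit /insert eqxx indicE mem_set.
apply: eq_bigr => i _.
by rewrite /visit -(remove_insert k z).
Qed.

Lemma expectation_visits n : ('E_P[visits n] = (n%:R * p)%:E)%E.
Proof.
have [|_ ->] := @expectation_sum_ord _ _ _ P n visit.
  by move=> k; exact: Lfun2_Lfun1 (visit_Lfun2 k).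
under eq_bigr do rewrite expectation_visit.
by rewrite sumEFin sumr_const card_ord mulr_natl.
Qed.

(** Erasing a visit lowers the count by one, so each of [n + 1] visits has covariance
    [p * (1 + n * p - (n + 1) * p)] with the total. *)
Lemma variance_visits n : ('V_P[visits n] = (n%:R * (p * (1 - p)))%:E)%E.
Proof.
rewrite /variance.
have [_ ->] := covariance_suml n visit_Lfun2 (visits_Lfun2 n).
case: n => [|n]; first by rewrite big_ord0 mul0r.
have N1 := Lfun2_Lfun1 (visits_Lfun2 n).
have h1 : cst 1 \+ visits n \in Lfun P 1 by rewrite rpredD// Lfun_cst.
have covE (k : 'I_n.+1) : covariance P (visit k) (visits n.+1) = (p * (1 - p))%:E.
  rewrite (covariance_visit (visits_Lfun2 n.+1) h1) => [|z Az]; last first.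
    by rewrite visits_insert// -ltnS.
  rewrite (expectationD (Lfun_cst _ _ _) N1) expectation_cst !expectation_visits.
  by congr (_%:E); rewrite /= -natr1; ring.
under eq_bigr do rewrite covE.
by rewrite sumEFin sumr_const card_ord mulr_natl.
Qed.

(* Erasing a visit to A turns Q n.+1 into Q n, so every visit is correlated with
   Q n.+1 through the increment of the expectation. *)
Lemma covariance_visits n (Q : nat -> Omega G -> R) :
  (forall m, Q m \in Lfun P 2%:E) ->
  (forall k z, (k <= n)%N -> A z.1 -> Q n.+1 (insert k z) = Q n z.2) ->
  (covariance P (visits n.+1) (Q n.+1) =
    (n.+1%:R * (p * (fine 'E_P[Q n] - fine 'E_P[Q n.+1])))%:E)%E.
Proof.
move=> Q2 Qins.
have [_ ->] := covariance_suml n.+1 visit_Lfun2 (Q2 n.+1).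
have covE (k : 'I_n.+1) : (covariance P (visit k) (Q n.+1) =
    (p * (fine 'E_P[Q n] - fine 'E_P[Q n.+1]))%:E)%E.
  apply: covariance_visit => // [|z Az]; first exact: Lfun2_Lfun1.
  by rewrite Qins// -ltnS.
under eq_bigr do rewrite covE.
by rewrite sumEFin sumr_const card_ord mulr_natl.
Qed.

Lemma variance_ge_increment n (Q : nat -> Omega G -> R) :
  0 < p ->
  (forall m, Q m \in Lfun P 2%:E) ->
  (forall k z, (k <= n)%N -> A z.1 -> Q n.+1 (insert k z) = Q n z.2) ->
  n.+1%:R * p * (fine 'E_P[Q n.+1]%E - fine 'E_P[Q n]%E) ^+ 2 <=
    fine 'V_P[Q n.+1]%E.
Proof.
move=> p0 Q2 Qins.
have := sqr_covariance_le (visits_Lfun2 n.+1) (Q2 n.+1).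
rewrite covariance_visits// variance_visits /=.
have v0 : 0 <= fine 'V_P[Q n.+1]%E by rewrite fine_ge0// variance_ge0.
have n0 : 0 < n.+1%:R :> R by rewrite ltr0n.
have np0 : 0 < n.+1%:R * p by rewrite mulr_gt0.
(* Multiplied by [n.+1 * p], the claim follows from Cauchy-Schwarz by bounding [1 - p] by 1; the
   term given up is the nonnegative one below. *)
move=> h; rewrite -(ler_pM2l np0).
have : 0 <= n.+1%:R * p * (p * fine 'V_P[Q n.+1]%E).
  by apply: mulr_ge0; [exact: ltW | apply: mulr_ge0 => //; exact: ltW].
move: h; lra.
Qed.

End visits.
End cocycle.

Theorem theorem4p12 (d : measure_display) (G : measurableType d) (R : realType)
    (mu : probability G R) (P : probability (Omega G) R)
    (hP : is_product_measure mu P)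
    (Q : nat -> Omega G -> R) (hQ : defective_adapted_cocycle Q)
    (hQ2 : finite_second_moment P Q) (hdev : second_moment_deviation P Q)
    (A : set G) (mA : measurable A) (muA : (0 < mu A)%E)
    (hA : consistent A Q) (hdrift : (0 < drift P Q)%E) :
  (0 < asymptotic_variance P Q)%E.
Proof.
have [Q0 _] := hQ; have [tau dev] := hdev; have [g [mg Qg gA]] := hA.
have Q2 := cocycle_Lfun2 hP mg Qg Q0 hQ2 dev.
have v_cvg := cocycle_variance_cvg hP mg Qg Q0 hQ2 dev.
have e_cvg := cocycle_expectation_cvg hP mg Qg Q0 hQ2 dev.
move: hdrift; rewrite (driftE hP mg Qg Q0 hQ2 dev).
rewrite (asymptotic_varianceE hP mg Qg Q0 hQ2 dev).
rewrite !lte_fin; set l := limn _; set s := limn _ => l0.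
have p0 : 0 < fine (mu A).
  by rewrite fine_gt0// muA /= ltey_eq fin_num_measure.
(* Consistency applied to [insert k z], whose entry at [k] lies in [A]. *)
have Qins n k z : (k <= n)%N -> A z.1 -> Q n.+1 (insert k z) = Q n z.2.
  move=> kn Az; rewrite (gA n.+1 k) ?remove_insert -?Qg//.
  by rewrite /insert eqxx.
have lin : \forall n \near \oo, l / 2 * n%:R <= fine 'E_P[Q n]%E.
  have l2 : l / 2 < l by rewrite ltr_pdivrMr// ltr_pMr// ltr1n.
  near=> n.
  have n0 : 0 < n%:R :> R by rewrite ltr0n; near: n; exact: nbhs_infty_gt.
  rewrite -ler_pdivlMr// [leRHS]mulrC ltW//; near: n.
  exact: (cvgr_gt l e_cvg).
have l20 : 0 < l / 2 by rewrite divr_gt0.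
have inc := increments_frequently_large l20 lin.
(* The slope [l / 2] is halved once more by the choice of large increments. *)
pose c := fine (mu A) * (l / 2 / 2) ^+ 2.
have c0 : 0 < c by rewrite mulr_gt0// exprn_gt0// divr_gt0.
(* If the limit were below [c], the normalised variances would eventually stay below [c], against
   the bound at a late large increment. *)
apply: (lt_le_trans c0); rewrite leNgt; apply/negP => sc.
have [N _ Nc] : \forall n \near \oo, n%:R^-1 * fine 'V_P[Q n]%E < c.
  exact: (cvgr_lt s v_cvg).
have [n [Nn incn]] := inc N.
have := Nc n.+1 (leqW Nn); rewrite /= ltNge => /negP; apply.
rewrite ler_pdivlMl ?ltr0n//.
apply: le_trans (variance_ge_increment hP mA p0 Q2 (Qins n)).
rewrite /c mulrA ler_wpM2l//; first by rewrite mulr_ge0 ?ler0n// ltW.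
by rewrite ler_sqr// nnegrE; [lra|apply: le_trans incn; lra].
Unshelve. all: by end_near. Qed.
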